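(* For every operator $\langle\mathsf{o}_1\rangle\in\{\langle\mathsf{sb}\rangle,\langle\mathsf{sw}\rangle\}$, we have $\mathcal{ML}(\langle\mathsf{o}_1\rangle)<\mathcal{HL}(:,\downarrow)$. For every operator $\langle\mathsf{o}_2\rangle\in\{\langle\mathsf{gsb}\rangle,\langle\mathsf{gsw}\rangle,\langle\mathsf{br}\rangle,\langle\mathsf{gbr}\rangle\}$, we have $\mathcal{ML}(\langle\mathsf{o}_2\rangle)<\mathcal{HL}(\mathsf{E},\downarrow)$. Here $\mathcal{L}<\mathcal{L}'$ means that $\mathcal{L}'$ is strictly more expressive than $\mathcal{L}$.
   Context: **Models.** $\mathcal{M}=\langle W,R,V\rangle$ with $W\neq\emptyset$, $R\subseteq W\times W$, $V:\mathsf{PROP}\to\mathcal{P}(W)$, where $\mathsf{PROP}$ is a countably infinite set of propositional symbols. A pointed model is a pair $\mathcal{M},w$ with $w\in W$. **Relation-changing logics.** For $\langle\mathsf{o}\rangle$ any one of the operators $\langle\mathsf{sb}\rangle,\langle\mathsf{br}\rangle,\langle\mathsf{sw}\rangle,\langle\mathsf{gsb}\rangle,\langle\mathsf{gbr}\rangle,\langle\mathsf{gsw}\rangle$, formulas of $\mathcal{ML}(\langle\mathsf{o}\rangle)$: $\bot\mid p\mid\neg\varphi\mid\varphi\wedge\psi\mid\Diamond\varphi\mid\langle\mathsf{o}\rangle\varphi$ with $p\in\mathsf{PROP}$. The Boolean clauses are as usual, $\mathcal{M},w\models p$ iff $w\in V(p)$, and $\mathcal{M},w\models\Diamond\varphi$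 iff $\mathcal{M},v\models\varphi$ for some $v$ with $(w,v)\in R$. Write $\mathcal{M}^-_{vu}$, $\mathcal{M}^+_{vu}$, $\mathcal{M}^*_{uv}$ for $\mathcal{M}$ with $R$ replaced by $R\setminus\{(v,u)\}$, $R\cup\{(v,u)\}$, $(R\setminus\{(v,u)\})\cup\{(u,v)\}$ respectively. Then: - $\mathcal{M},w\models\langle\mathsf{sb}\rangle\varphi$ iff for some $v$ with $(w,v)\in R$, $\mathcal{M}^-_{wv},v\models\varphi$; - $\mathcal{M},w\models\langle\mathsf{br}\rangle\varphi$ iff for some $v\in W$ with $(w,v)\notin R$, $\mathcal{M}^+_{wv},v\models\varphi$; - $\mathcal{M},w\models\langle\mathsf{sw}\rangle\varphi$ iff for some $v$ with $(w,v)\in R$, $\mathcal{M}^*_{vw},v\models\varphi$; - $\mathcal{M},w\models\langle\mathsf{gsb}\rangle\varphi$ iff for some $(v,u)\in R$, $\mathcal{M}^-_{vu},w\models\varphi$; - $\mathcal{M},w\models\langle\mathsf{gbr}\rangle\varphi$ iff for some $v,u\in W$ with $(v,u)\notin R$, $\mathcal{M}^+_{vu},w\models\varphi$; - $\mathcal{M},w\models\langle\mathsf{gsw}\rangle\varphi$ iff for some $(v,u)\in R$, $\mathcal{M}^*_{uv},w\models\varphi$. **Hybrid logics.** Let $\mathsf{NOM}$ be a countably infinite set of nominals, disjoint from $\mathsf{PROP}$; in a hybrid model, $V$ also assigns to each nominal a singleton subset of $W$. $\mathcal{HL}(:,\downarrow)$ is built from propositional symbols and nominals with $\bot,\neg,\wedge,\Diamond$,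 $n{:}\varphi$ and $\downarrow n.\varphi$ ($n\in\mathsf{NOM}$); $\mathcal{HL}(\mathsf{E},\downarrow)$ has $\mathsf{E}$ instead of $:$. A nominal $n$ is true at $w$ iff $V(n)=\{w\}$; $\mathcal{M},w\models n{:}\varphi$ iff $\mathcal{M},v\models\varphi$ where $V(n)=\{v\}$; $\mathcal{M},w\models\mathsf{E}\varphi$ iff $\mathcal{M},v\models\varphi$ for some $v\in W$; $\langle W,R,V\rangle,w\models\,\downarrow n.\varphi$ iff $\langle W,R,V_n^w\rangle,w\models\varphi$, where $V_n^w$ agrees with $V$ except $V_n^w(n)=\{w\}$. Hybrid formulas are compared here as formulas in which every nominal occurrence is bound by $\downarrow$, so that their truth at a pointed model over $\mathsf{PROP}$ does not depend on how nominals are interpreted. **Expressive power.** $\mathcal{L}\leq\mathcal{L}'$ iff there is a function $\mathsf{Tr}$ from formulas of $\mathcal{L}$ to formulas of $\mathcal{L}'$ such that for every pointed model $\mathcal{M},w$ and every formula $\varphi$ of $\mathcal{L}$: $\mathcal{M},w\models_{\mathcal{L}}\varphi$ iff $\mathcal{M},w\models_{\mathcal{L}'}\mathsf{Tr}(\varphi)$. $\mathcal{L}<\mathcal{L}'$ iff $\mathcal{L}\leq\mathcal{L}'$ and not $\mathcal{L}'\leq\mathcal{L}$. *)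

(* Defs.v *)
From Stdlib Require Import Arith.

Set Implicit Arguments.

(* Propositional symbols and nominals are two countably infinite sets of names;
   disjointness is ensured by the separate formula constructors for them. *)
Definition PROP : Set := nat.
Definition NOM : Set := nat.

Record model : Type := Model {
  world :> Type;
  world_inhabited : inhabited world;
  rel : world -> world -> Prop;
  val : PROP -> world -> Prop
}.

Definition set_rel (M : model) (S : M -> M -> Prop) : model :=
  Model (world_inhabited M) S (@val M).

(* R \ {(v,u)} *)
Definition rel_del (M : model) (v u : M) : model :=
  set_rel M (fun x y => rel M x y /\ ~ (x = v /\ y = u)).

(* R U {(v,u)} *)
Definition rel_add (M : model) (v u : M) : model :=
  set_rel M (fun x y => rel M x y \/ (x = v /\ y = u)).

(* (R \ {(v,u)}) U {(u,v)}: note that it is the edge (v,u), not (u,v), that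
   gets reversed *)
Definition rel_swap (M : model) (u v : M) : model :=
  set_rel M (fun x y => (rel M x y /\ ~ (x = v /\ y = u)) \/ (x = u /\ y = v)).

Arguments rel_del : clear implicits.
Arguments rel_add : clear implicits.
Arguments rel_swap : clear implicits.

Inductive rc_op : Set := sb | br | sw | gsb | gbr | gsw.

Inductive ml_form (o : rc_op) : Set :=
| MBot : ml_form o
| MProp : PROP -> ml_form o
| MNeg : ml_form o -> ml_form o
| MAnd : ml_form o -> ml_form o -> ml_form o
| MDia : ml_form o -> ml_form o
| MOp : ml_form o -> ml_form o.

Fixpoint ml_sat (o : rc_op) (M : model) (w : M) (phi : ml_form o) {struct phi}
    : Prop :=
  match phi with
  | MBot _ => False
  | MProp _ p => val M p w
  | MNeg a => ~ ml_sat M w a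
  | MAnd a b => ml_sat M w a /\ ml_sat M w b
  | MDia a => exists v : M, rel M w v /\ ml_sat M v a
  | MOp a =>
    match o with
    | sb => exists v : M, rel M w v /\ ml_sat (rel_del M w v) v a
    | br => exists v : M, ~ rel M w v /\ ml_sat (rel_add M w v) v a
    | sw => exists v : M, rel M w v /\ ml_sat (rel_swap M v w) v a
    | gsb => exists v u : M, rel M v u /\ ml_sat (rel_del M v u) w a
    | gbr => exists v u : M, ~ rel M v u /\ ml_sat (rel_add M v u) w a
    | gsw => exists v u : M, rel M v u /\ ml_sat (rel_swap M u v) w a
    end
  end.

(* A valuation of nominals by singletons, V(n) = {g n}. *)
Definition nom_val (M : model) : Type := NOM -> M.

Definition nom_upd (M : model) (g : nom_val M) (n : NOM) (w : M) : nom_val M :=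
  fun m => if Nat.eqb m n then w else g m.

Inductive hat_form : Set :=
| ABot : hat_form
| AProp : PROP -> hat_form
| ANom : NOM -> hat_form
| ANeg : hat_form -> hat_form
| AAnd : hat_form -> hat_form -> hat_form
| ADia : hat_form -> hat_form
| AAt : NOM -> hat_form -> hat_form
| ADown : NOM -> hat_form -> hat_form.

Fixpoint hat_sat (M : model) (g : nom_val M) (w : M) (phi : hat_form) : Prop :=
  match phi with
  | ABot => False
  | AProp p => val M p w
  | ANom n => g n = w
  | ANeg a => ~ hat_sat g w a
  | AAnd a b => hat_sat g w a /\ hat_sat g w b
  | ADia a => exists v : M, rel M w v /\ hat_sat g v a
  | AAt n a => hat_sat g (g n) a
  | ADown n a => hat_sat (nom_upd g n w) w a
  end.

Fixpoint hat_free (n : NOM) (phi : hat_form) : Prop :=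
  match phi with
  | ABot | AProp _ => False
  | ANom m => n = m
  | ANeg a | ADia a => hat_free n a
  | AAnd a b => hat_free n a \/ hat_free n b
  | AAt m a => n = m \/ hat_free n a
  | ADown m a => n <> m /\ hat_free n a
  end.

Definition hat_closed (phi : hat_form) : Prop := forall n, ~ hat_free n phi.

Inductive he_form : Set :=
| EBot : he_form
| EProp : PROP -> he_form
| ENom : NOM -> he_form
| ENeg : he_form -> he_form
| EAnd : he_form -> he_form -> he_form
| EDia : he_form -> he_form
| EEx : he_form -> he_form
| EDown : NOM -> he_form -> he_form.

Fixpoint he_sat (M : model) (g : nom_val M) (w : M) (phi : he_form) : Prop :=
  match phi with
  | EBot => False
  | EProp p => val M p w
  | ENom n => g n = w
  | ENeg a => ~ he_sat g w a
  | EAnd a b => he_sat g w a /\ he_sat g w b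
  | EDia a => exists v : M, rel M w v /\ he_sat g v a
  | EEx a => exists v : M, he_sat g v a
  | EDown n a => he_sat (nom_upd g n w) w a
  end.

Fixpoint he_free (n : NOM) (phi : he_form) : Prop :=
  match phi with
  | EBot | EProp _ => False
  | ENom m => n = m
  | ENeg a | EDia a | EEx a => he_free n a
  | EAnd a b => he_free n a \/ he_free n b
  | EDown m a => n <> m /\ he_free n a
  end.

Definition he_closed (phi : he_form) : Prop := forall n, ~ he_free n phi.

Record logic : Type := Logic {
  form : Type;
  sat : forall M : model, M -> form -> Prop
}.

Definition ML (o : rc_op) : logic := Logic (@ml_sat o).

(* The truth value of a closed formula does not depend on the valuation g of the
   nominals (see [hat_sat_closed] and [he_sat_closed]), so quantifying over g
   universally or existentially makes no difference. *)
Definition HL_at_down : logic :=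
  Logic (fun (M : model) (w : M) (phi : {phi : hat_form | hat_closed phi}) =>
           forall g : nom_val M, hat_sat g w (proj1_sig phi)).

Definition HL_E_down : logic :=
  Logic (fun (M : model) (w : M) (phi : {phi : he_form | he_closed phi}) =>
           forall g : nom_val M, he_sat g w (proj1_sig phi)).

Definition leq_expr (L L' : logic) : Prop :=
  exists Tr : form L -> form L',
    forall (M : model) (w : M) (phi : form L),
      sat L M w phi <-> sat L' M w (Tr phi).

Definition lt_expr (L L' : logic) : Prop := leq_expr L L' /\ ~ leq_expr L' L.

Lemma nom_upd_agree (M : model) (P : NOM -> Prop) (n : NOM) (w : M)
    (g h : nom_val M) :
  (forall m, m <> n /\ P m -> g m = h m) ->
  forall m, P m -> nom_upd g n w m = nom_upd h n w m.
Proof.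
  intros H m Pm; unfold nom_upd.
  destruct (Nat.eqb_spec m n); auto.
Qed.

Lemma hat_sat_agree (phi : hat_form) :
  forall (M : model) (w : M) (g h : nom_val M),
    (forall n, hat_free n phi -> g n = h n) ->
    hat_sat g w phi <-> hat_sat h w phi.
Proof.
  induction phi as [|p|n|a IHa|a IHa b IHb|a IHa|n a IHa|n a IHa];
    intros M w g h H; simpl in *.
  - tauto.
  - tauto.
  - rewrite (H n eq_refl); tauto.
  - rewrite (IHa M w g h H); tauto.
  - rewrite (IHa M w g h), (IHb M w g h); auto; tauto.
  - split; intros [v [Hv Ha]]; exists v; split; auto; apply (IHa M v g h H); auto.
  - rewrite (H n (or_introl eq_refl)); apply IHa; auto.
  - apply IHa, nom_upd_agree; exact H.
Qed.

Lemma hat_sat_closed (phi : hat_form) (M : model) (w : M) (g h : nom_val M) :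
  hat_closed phi -> hat_sat g w phi <-> hat_sat h w phi.
Proof.
  intros C; apply hat_sat_agree; intros n Hn; destruct (C n Hn).
Qed.

Lemma he_sat_agree (phi : he_form) :
  forall (M : model) (w : M) (g h : nom_val M),
    (forall n, he_free n phi -> g n = h n) ->
    he_sat g w phi <-> he_sat h w phi.
Proof.
  induction phi as [|p|n|a IHa|a IHa b IHb|a IHa|a IHa|n a IHa];
    intros M w g h H; simpl in *.
  - tauto.
  - tauto.
  - rewrite (H n eq_refl); tauto.
  - rewrite (IHa M w g h H); tauto.
  - rewrite (IHa M w g h), (IHb M w g h); auto; tauto.
  - split; intros [v [Hv Ha]]; exists v; split; auto; apply (IHa M v g h H); auto.
  - split; intros [v Ha]; exists v; apply (IHa M v g h H); auto.
  - apply IHa, nom_upd_agree; exact H.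
Qed.

Lemma he_sat_closed (phi : he_form) (M : model) (w : M) (g h : nom_val M) :
  he_closed phi -> he_sat g w phi <-> he_sat h w phi.
Proof.
  intros C; apply he_sat_agree; intros n Hn; destruct (C n Hn).
Qed.

(* Main.v *)
(** Inclusion: the translation names both ends of every edge it edits, so that
    after finitely many edits the current relation is definable from the original
    one and the named points.  A successor in the edited relation is either an
    original successor or a named point, which is why [sb] and [sw] need no
    existential modality.

    Strictness: if no symbol holds anywhere and every point has infinitely many
    successors and infinitely many non-successors, then the same is true after any
    edit, so all six operators are always executable and all such pointed models
    satisfy the same formulas of ML(o).  On the natural numbers with [R x y] iff
    [y] is even, both 0 and 1 are of this kind, but only 0 satisfies
    "down n. Dia n". *)

From Stdlib Require Import Arith Lia List Classical.
Require Import Defs.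

Set Implicit Arguments.

Lemma nom_upd_same (M : model) (g : nom_val M) (n : NOM) (w : M) :
  nom_upd g n w n = w.
Proof. unfold nom_upd; now rewrite Nat.eqb_refl. Qed.

Lemma nom_upd_lt (M : model) (g : nom_val M) (n m : NOM) (w : M) :
  m < n -> nom_upd g n w m = g m.
Proof.
  intros H; unfold nom_upd; destruct (Nat.eqb_spec m n); [unfold NOM in *; lia | easy].
Qed.

(** * Edited relations *)

(** Edits refer to points by nominals, so that formulas can speak of them. The head of a list is the
    latest edit. A swap is a [Del] followed by an [Add], in this order so that swapping a loop keeps
    it. *)
Inductive edit : Set := Del (a b : NOM) | Add (a b : NOM).

Fixpoint edited (M : model) (g : nom_val M) (E : list edit) (x y : M) : Prop :=
  match E with
  | nil => rel M x y
  | Del a b :: E => edited g E x y /\ ~ (x = g a /\ y = g b)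
  | Add a b :: E => edited g E x y \/ (x = g a /\ y = g b)
  end.

Fixpoint bounded (k : nat) (E : list edit) : Prop :=
  match E with
  | nil => True
  | Del a b :: E | Add a b :: E => a < k /\ b < k /\ bounded k E
  end.

Lemma bounded_le (k l : nat) (E : list edit) : k <= l -> bounded k E -> bounded l E.
Proof.
  intros H; induction E as [|[a b|a b] E IH]; simpl; unfold NOM in *; intuition lia.
Qed.

Lemma edited_agree (M : model) (g h : nom_val M) (k : nat) (E : list edit) (x y : M) :
  (forall n, n < k -> g n = h n) -> bounded k E ->
  edited g E x y <-> edited h E x y.
Proof.
  intros H; induction E as [|[a b|a b] E IH]; simpl; [tauto | |];
    intros (Ha & Hb & HS); rewrite (IH HS), (H a Ha), (H b Hb); tauto.
Qed.

(** Only [Add] creates edges, and their targets are named. This is what lets [:] replace [E] in the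
    translation of [sb] and [sw]. *)
Lemma edited_target (M : model) (g : nom_val M) (k : nat) (E : list edit) (x y : M) :
  bounded k E -> edited g E x y -> rel M x y \/ exists n, n < k /\ y = g n.
Proof.
  induction E as [|[a b|a b] E IH]; simpl; [tauto | |]; intros (Ha & Hb & HS).
  - tauto.
  - intros [H | [_ H]]; [auto | eauto].
Qed.

Definition hat_or (a b : hat_form) : hat_form := ANeg (AAnd (ANeg a) (ANeg b)).

(** Disjunction is encoded by negation and conjunction, so the forward direction needs excluded
    middle. *)
Lemma hat_sat_or (M : model) (g : nom_val M) (w : M) (a b : hat_form) :
  hat_sat g w (hat_or a b) <-> hat_sat g w a \/ hat_sat g w b.
Proof. simpl; tauto. Qed.

Fixpoint edge (E : list edit) (x y : NOM) : hat_form :=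
  match E with
  | nil => AAt x (ADia (ANom y))
  | Del a b :: E =>
      AAnd (edge E x y) (ANeg (AAnd (AAt x (ANom a)) (AAt y (ANom b))))
  | Add a b :: E =>
      hat_or (edge E x y) (AAnd (AAt x (ANom a)) (AAt y (ANom b)))
  end.

Lemma edge_sat (M : model) (g : nom_val M) (w : M) (E : list edit) (x y : NOM) :
  hat_sat g w (edge E x y) <-> edited g E (g x) (g y).
Proof.
  induction E as [|[a b|a b] E IH]; cbn [edge edited].
  - simpl; split; [intros (v & H & <-) | intros H; exists (g y)]; auto.
  - simpl; rewrite IH; split; intros [H H0]; split; auto; intros [H1 H2]; auto.
  - rewrite hat_sat_or, IH; simpl; split; intros [H | [H1 H2]]; auto.
Qed.

Lemma edge_free (k : nat) (E : list edit) (x y n : NOM) :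
  x < k -> y < k -> bounded k E -> hat_free n (edge E x y) -> n < k.
Proof.
  intros Hx Hy; induction E as [|[a b|a b] E IH]; simpl; intros HS Hn;
    intuition (subst; auto).
Qed.

Lemma edge_sat_fresh (M : model) (g : nom_val M) (w v z : M) (k : nat)
    (E : list edit) :
  bounded k E ->
  hat_sat (nom_upd (nom_upd g k w) (k + 1) v) z (edge E k (k + 1)) <->
  edited g E w v.
Proof.
  intros HS; rewrite edge_sat, nom_upd_same, nom_upd_lt, nom_upd_same by lia.
  apply edited_agree with k; auto; intros n Hn; rewrite !nom_upd_lt; auto; lia.
Qed.

(** * Translation into HL(:,down) *)

Fixpoint hat_some_named (k : nat) (a : hat_form) : hat_form :=
  match k with
  | 0 => ABot
  | S k => hat_or (AAt k a) (hat_some_named k a)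
  end.

Lemma hat_some_named_sat (M : model) (g : nom_val M) (w : M) (k : nat) (a : hat_form) :
  hat_sat g w (hat_some_named k a) <-> exists n, n < k /\ hat_sat g (g n) a.
Proof.
  induction k as [|k IH]; cbn [hat_some_named].
  - split; [easy | intros (n & H & _); lia].
  - rewrite hat_sat_or, IH; simpl; split.
    + intros [H | (n & Hn & H)]; eauto.
    + intros (n & Hn & H); destruct (Nat.eq_dec n k) as [-> | Hk]; auto.
      right; exists n; split; [lia | auto].
Qed.

Lemma hat_some_named_free (k : nat) (a : hat_form) (n : NOM) :
  hat_free n (hat_some_named k a) -> n < k \/ hat_free n a.
Proof.
  induction k as [|k IH]; simpl; [easy|].
  unfold NOM in *; intros [[-> | H] | H]; [left; lia | auto |].
  destruct (IH H); [left; lia | auto].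
Qed.

(** The candidates, original successors and named points, may include more than the successors in
    the edited relation. The guard [edge E k (k + 1)] put into [a] filters them. *)
Definition hat_step (k : nat) (a : hat_form) : hat_form :=
  ADown k (hat_or (ADia (ADown (k + 1) a)) (hat_some_named k (ADown (k + 1) a))).

Lemma hat_step_sat (M : model) (g : nom_val M) (w : M) (k : nat) (a : hat_form) :
  hat_sat g w (hat_step k a) <->
  exists v, (rel M w v \/ exists n, n < k /\ v = g n) /\
    hat_sat (nom_upd (nom_upd g k w) (k + 1) v) v a.
Proof.
  unfold hat_step; cbn [hat_sat]; rewrite hat_sat_or, hat_some_named_sat.
  cbn [hat_sat]; split.
  - intros [(v & Hv & H) | (n & Hn & H)]; [eauto|].
    rewrite (nom_upd_lt g w Hn) in H; eauto 6.
  - intros (v & [Hv | (n & Hn & ->)] & H); [eauto|].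
    right; exists n; rewrite (nom_upd_lt g w Hn); auto.
Qed.

Lemma hat_step_free (k : nat) (a : hat_form) (n : NOM) :
  (hat_free n a -> n < k + 2) -> hat_free n (hat_step k a) -> n < k.
Proof.
  unfold hat_step, hat_or; simpl; intros Ha [Hk [[H1 H2] | H]].
  - specialize (Ha H2); unfold NOM in *; lia.
  - apply hat_some_named_free in H; destruct H as [H | [H1 H2]]; auto.
    specialize (Ha H2); unfold NOM in *; lia.
Qed.

(* All nominals below [k] are in scope; [k] and [k + 1] are fresh. *)
Fixpoint hat_tr (o : rc_op) (k : nat) (E : list edit) (phi : ml_form o) : hat_form :=
  match phi with
  | MBot _ => ABot
  | MProp _ p => AProp p
  | MNeg a => ANeg (hat_tr k E a)
  | MAnd a b => AAnd (hat_tr k E a) (hat_tr k E b)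
  | MDia a => hat_step k (AAnd (edge E k (k + 1)) (hat_tr (k + 2) E a))
  | MOp a =>
    match o with
    | sb => hat_step k (AAnd (edge E k (k + 1))
              (hat_tr (k + 2) (Del k (k + 1) :: E) a))
    | sw => hat_step k (AAnd (edge E k (k + 1))
              (hat_tr (k + 2) (Add (k + 1) k :: Del k (k + 1) :: E) a))
    (* A dummy value: correctness is claimed only for [sb] and [sw]. *)
    | _ => ABot
    end
  end.

Lemma hat_tr_free (o : rc_op) (phi : ml_form o) (n : NOM) :
  forall k E, bounded k E -> hat_free n (hat_tr k E phi) -> n < k.
Proof.
  assert (Hstep : forall k E T (a : ml_form o), bounded k E -> bounded (k + 2) T ->
    (forall k E, bounded k E -> hat_free n (hat_tr k E a) -> n < k) ->
    hat_free n (hat_step k (AAnd (edge E k (k + 1)) (hat_tr (k + 2) T a))) -> n < k).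
  { intros k E T a HS HT IH; apply hat_step_free; simpl; intros [H | H]; eauto.
    apply edge_free with (k := k + 2) in H; auto; try lia.
    apply bounded_le with k; auto; lia. }
  induction phi as [|p|a IHa|a IHa b IHb|a IHa|a IHa]; intros k E HS; simpl; try easy.
  - now apply IHa.
  - intros [H | H]; eauto.
  - apply Hstep; auto; apply bounded_le with k; auto; lia.
  - assert (HS2 : bounded (k + 2) E) by (apply bounded_le with k; auto; lia).
    destruct o; try easy; apply Hstep; auto; simpl; repeat split; auto; lia.
Qed.

(* [R] is compared with [edited g E] only up to equivalence, because updating [g]
   at a fresh nominal changes [edited g E] as a term. *)
Lemma hat_tr_sat (o : rc_op) (phi : ml_form o) (M : model) :
  o = sb \/ o = sw ->
  forall k E (g : nom_val M) (R : M -> M -> Prop) (w : M),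
  bounded k E -> (forall x y, R x y <-> edited g E x y) ->
  ml_sat (set_rel M R) w phi <-> hat_sat g w (hat_tr k E phi).
Proof.
  intros Ho.
  (* The common shape of [MDia], [sb] and [sw]: the step follows [R], described by [E], while the
     rest is evaluated in [R' w v], described by [T]. *)
  assert (Hstep : forall k E T (g : nom_val M) (R : M -> M -> Prop)
      (R' : M -> M -> M -> M -> Prop) (w : M) (a : ml_form o),
    bounded k E -> bounded (k + 2) T ->
    (forall x y, R x y <-> edited g E x y) ->
    (forall v x y,
       R' w v x y <-> edited (nom_upd (nom_upd g k w) (k + 1) v) T x y) ->
    (forall k E (g : nom_val M) (R : M -> M -> Prop) (w : M),
       bounded k E -> (forall x y, R x y <-> edited g E x y) ->
       ml_sat (set_rel M R) w a <-> hat_sat g w (hat_tr k E a)) ->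
    (exists v : M, R w v /\ ml_sat (set_rel M (R' w v)) v a) <->
    hat_sat g w (hat_step k (AAnd (edge E k (k + 1)) (hat_tr (k + 2) T a)))).
  { intros k E T g R R' w a HS HT HR HR' IH; rewrite hat_step_sat; cbn [hat_sat].
    split.
    - intros (v & Hv & H); exists v; rewrite edge_sat_fresh by auto.
      apply HR in Hv; repeat split; auto.
      + eapply edited_target; eauto.
      + eapply IH; eauto.
    - intros (v & _ & Hv & H); exists v; rewrite edge_sat_fresh in Hv by auto.
      split; [now apply HR | eapply IH; eauto]. }
  induction phi as [|p|a IHa|a IHa b IHb|a IHa|a IHa];
    intros k E g R w HS HR; cbn [ml_sat hat_tr].
  - easy.
  - easy.
  - cbn [hat_sat]; rewrite (IHa k E g R w); easy.
  - cbn [hat_sat]; rewrite (IHa k E g R w), (IHb k E g R w); easy.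
  - assert (HS2 : bounded (k + 2) E) by (apply bounded_le with k; auto; lia).
    apply (Hstep k E E g R (fun _ _ => R)); auto.
    intros v x y; rewrite HR; apply edited_agree with k; auto.
    intros n Hn; rewrite !nom_upd_lt; auto; lia.
  - assert (HS2 : bounded (k + 2) E) by (apply bounded_le with k; auto; lia).
    assert (HR' : forall v x y,
      R x y <-> edited (nom_upd (nom_upd g k w) (k + 1) v) E x y).
    { intros v x y; rewrite HR; apply edited_agree with k; auto.
      intros n Hn; rewrite !nom_upd_lt; auto; lia. }
    destruct Ho as [-> | ->].
    (* Editing [set_rel M R] is convertible with setting the edited relation on [M] directly. *)
    + apply (Hstep k E _ g R (fun w v x y => R x y /\ ~ (x = w /\ y = v)));
        auto; simpl; [repeat split; auto; lia|].
      intros v x y; rewrite (HR' v).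
      rewrite nom_upd_same, nom_upd_lt, nom_upd_same by lia; tauto.
    + apply (Hstep k E _ g R
        (fun w v x y => (R x y /\ ~ (x = w /\ y = v)) \/ (x = v /\ y = w)));
        auto; simpl; [repeat split; auto; lia|].
      intros v x y; rewrite (HR' v).
      rewrite nom_upd_same, nom_upd_lt, nom_upd_same by lia; tauto.
Qed.

Lemma leq_expr_hat (o : rc_op) : o = sb \/ o = sw -> leq_expr (ML o) HL_at_down.
Proof.
  intros Ho.
  assert (C : forall phi : ml_form o, hat_closed (hat_tr 0 nil phi)).
  { intros phi n Hn; apply hat_tr_free in Hn; simpl; auto; inversion Hn. }
  exists (fun phi => exist hat_closed (hat_tr 0 nil phi) (C phi)).
  intros M w phi; simpl.
  assert (H : forall g, ml_sat M w phi <-> hat_sat g w (hat_tr 0 nil phi)).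
  { intros g; destruct M as [W i R V].
    (* Only for an explicit [Model] is resetting the relation to itself convertible with the
       model. *)
    apply (hat_tr_sat phi (M := Model i R V) Ho); simpl; easy. }
  split; [intros Hw g; now apply H | intros Hg; apply (H (fun _ => w)), Hg].
Qed.

(** * Translation into HL(E,down) *)

Definition he_at (n : NOM) (a : he_form) : he_form := EEx (EAnd (ENom n) a).

Lemma he_at_sat (M : model) (g : nom_val M) (w : M) (n : NOM) (a : he_form) :
  he_sat g w (he_at n a) <-> he_sat g (g n) a.
Proof. simpl; split; [now intros (v & <- & H) | eauto]. Qed.

(** Since [E] defines [:], the formulas [edge] and their correctness carry over without a second
    induction on the edits. *)
Fixpoint he_of_hat (phi : hat_form) : he_form :=
  match phi with
  | ABot => EBot
  | AProp p => EProp p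
  | ANom n => ENom n
  | ANeg a => ENeg (he_of_hat a)
  | AAnd a b => EAnd (he_of_hat a) (he_of_hat b)
  | ADia a => EDia (he_of_hat a)
  | AAt n a => he_at n (he_of_hat a)
  | ADown n a => EDown n (he_of_hat a)
  end.

Lemma he_of_hat_sat (phi : hat_form) (M : model) :
  forall (g : nom_val M) (w : M), he_sat g w (he_of_hat phi) <-> hat_sat g w phi.
Proof.
  induction phi as [|p|n|a IHa|a IHa b IHb|a IHa|n a IHa|n a IHa];
    intros g w; cbn [he_of_hat]; try rewrite he_at_sat; simpl; try easy.
  - now rewrite IHa.
  - now rewrite IHa, IHb.
  - split; intros (v & Hv & H); exists v; split; auto; now apply IHa.
Qed.

Lemma he_of_hat_free (n : NOM) (phi : hat_form) :
  he_free n (he_of_hat phi) <-> hat_free n phi.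
Proof. induction phi; simpl; tauto. Qed.

Definition he_edge (E : list edit) (x y : NOM) : he_form := he_of_hat (edge E x y).

Lemma he_edge_sat (M : model) (g : nom_val M) (w : M) (E : list edit) (x y : NOM) :
  he_sat g w (he_edge E x y) <-> edited g E (g x) (g y).
Proof. unfold he_edge; rewrite he_of_hat_sat; apply edge_sat. Qed.

Definition he_step (k : nat) (a : he_form) : he_form :=
  EDown k (EEx (EDown (k + 1) a)).

(** Global operators do not move the evaluation point: it is named [k], the two ends of the edge are
    named [k + 1] and [k + 2], and [he_at k] returns. *)
Definition he_pair (k : nat) (a : he_form) : he_form :=
  EDown k (EEx (EDown (k + 1) (EEx (EDown (k + 2) (he_at k a))))).

Fixpoint he_tr (o : rc_op) (k : nat) (E : list edit) (phi : ml_form o) : he_form :=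
  match phi with
  | MBot _ => EBot
  | MProp _ p => EProp p
  | MNeg a => ENeg (he_tr k E a)
  | MAnd a b => EAnd (he_tr k E a) (he_tr k E b)
  | MDia a => he_step k (EAnd (he_edge E k (k + 1)) (he_tr (k + 2) E a))
  | MOp a =>
    let E1 := he_edge E k (k + 1) in
    let E2 := he_edge E (k + 1) (k + 2) in
    match o with
    | sb => he_step k (EAnd E1 (he_tr (k + 2) (Del k (k + 1) :: E) a))
    | br => he_step k (EAnd (ENeg E1) (he_tr (k + 2) (Add k (k + 1) :: E) a))
    | sw => he_step k (EAnd E1
              (he_tr (k + 2) (Add (k + 1) k :: Del k (k + 1) :: E) a))
    | gsb => he_pair k (EAnd E2 (he_tr (k + 3) (Del (k + 1) (k + 2) :: E) a))
    | gbr => he_pair k (EAnd (ENeg E2)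
              (he_tr (k + 3) (Add (k + 1) (k + 2) :: E) a))
    | gsw => he_pair k (EAnd E2
              (he_tr (k + 3) (Add (k + 2) (k + 1) :: Del (k + 1) (k + 2) :: E) a))
    end
  end.

Lemma he_tr_free (o : rc_op) (phi : ml_form o) (n : NOM) :
  forall k E, bounded k E -> he_free n (he_tr k E phi) -> n < k.
Proof.
  assert (HE : forall k l E x y, bounded k E -> k <= l -> x < l -> y < l ->
    he_free n (he_edge E x y) -> n < l).
  { intros k l E x y HS Hl Hx Hy H; unfold he_edge in H; rewrite he_of_hat_free in H.
    apply edge_free with (k := l) in H; auto; apply bounded_le with k; auto. }
  induction phi as [|p|a IHa|a IHa b IHb|a IHa|a IHa]; intros k E HS; try easy.
  - apply IHa, HS.
  - intros [H | H]; eauto.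
  - intros [H0 [H1 [H | H]]].
    + apply (HE k (k + 2)) in H; auto; unfold NOM in *; lia.
    + apply IHa in H; [unfold NOM in *; lia | apply bounded_le with k; auto; lia].
  - assert (H2 : bounded (k + 2) E) by (apply bounded_le with k; auto; lia).
    assert (H3 : bounded (k + 3) E) by (apply bounded_le with k; auto; lia).
    destruct o; simpl; intros Hn; decompose [and or] Hn; clear Hn;
      try (match goal with
           | H : he_free n (he_edge E k (k + 1)) |- _ => apply (HE k (k + 2)) in H
           | H : he_free n (he_edge E (k + 1) (k + 2)) |- _ => apply (HE k (k + 3)) in H
           | H : he_free n (he_tr _ _ a) |- _ => apply IHa in H
           end);
      simpl; auto; repeat split; auto; unfold NOM in *; lia.
Qed.

Lemma he_pair_sat (M : model) (g : nom_val M) (w : M) (k : nat) (a : he_form) :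
  he_sat g w (he_pair k a) <->
  exists v u,
    he_sat (nom_upd (nom_upd (nom_upd g k w) (k + 1) v) (k + 2) u) w a.
Proof.
  unfold he_pair; cbn [he_sat].
  split; intros (v & u & H); exists v, u; revert H; rewrite he_at_sat;
    now rewrite !nom_upd_lt, nom_upd_same by lia.
Qed.

Lemma he_tr_sat (o : rc_op) (phi : ml_form o) (M : model) :
  forall k E (g : nom_val M) (R : M -> M -> Prop) (w : M),
  bounded k E -> (forall x y, R x y <-> edited g E x y) ->
  ml_sat (set_rel M R) w phi <-> he_sat g w (he_tr k E phi).
Proof.
  set (correct a := forall k E (g : nom_val M) (R : M -> M -> Prop) (w : M),
    bounded k E -> (forall x y, R x y <-> edited g E x y) ->
    ml_sat (set_rel M R) w a <-> he_sat g w (he_tr (o := o) k E a)).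
  (* The guard [C] is left abstract, since it is an edge for [MDia], [sb] and [sw] but a missing
     edge for [br]. [Hpair] is the analogue for global operators. *)
  assert (Hstep : forall k T (g : nom_val M) (w : M) (C : M -> Prop) c
      (R' : M -> M -> M -> Prop) a,
    let g2 v := nom_upd (nom_upd g k w) (k + 1) v in
    bounded (k + 2) T -> correct a ->
    (forall v, C v <-> he_sat (g2 v) v c) ->
    (forall v x y, R' v x y <-> edited (g2 v) T x y) ->
    (exists v, C v /\ ml_sat (set_rel M (R' v)) v a) <->
    he_sat g w (he_step k (EAnd c (he_tr (k + 2) T a)))).
  { intros k T g w C c R' a g2 HT IH HC HR'; unfold he_step; cbn [he_sat].
    split; intros (v & Hv & H); exists v; split;
      try (now apply HC); eapply (IH (k + 2) T (g2 v)); eauto. }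
  assert (Hpair : forall k T (g : nom_val M) (w : M) (C : M -> M -> Prop) c
      (R' : M -> M -> M -> M -> Prop) a,
    let g3 v u := nom_upd (nom_upd (nom_upd g k w) (k + 1) v) (k + 2) u in
    bounded (k + 3) T -> correct a ->
    (forall v u, C v u <-> he_sat (g3 v u) w c) ->
    (forall v u x y, R' v u x y <-> edited (g3 v u) T x y) ->
    (exists v u, C v u /\ ml_sat (set_rel M (R' v u)) w a) <->
    he_sat g w (he_pair k (EAnd c (he_tr (k + 3) T a)))).
  { intros k T g w C c R' a g3 HT IH HC HR'; rewrite he_pair_sat; cbn [he_sat].
    split; intros (v & u & Hv & H); exists v, u; split;
      try (now apply HC); eapply (IH (k + 3) T (g3 v u)); eauto. }
  induction phi as [|p|a IHa|a IHa b IHb|a IHa|a IHa];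
    intros k E g R w HE HR; cbn [ml_sat he_tr].
  1, 2: easy.
  1: cbn [he_sat]; rewrite (IHa k E g R w); easy.
  1: cbn [he_sat]; rewrite (IHa k E g R w), (IHb k E g R w); easy.
  all: assert (B2 : bounded (k + 2) E) by (apply bounded_le with k; auto; lia).
  all: assert (B3 : bounded (k + 3) E) by (apply bounded_le with k; auto; lia).
  all: assert (HR2 : forall v x y,
         R x y <-> edited (nom_upd (nom_upd g k w) (k + 1) v) E x y)
    by (intros v x y; rewrite HR; apply edited_agree with k; auto;
        intros n Hn; rewrite !nom_upd_lt; auto; lia).
  all: assert (HR3 : forall v u x y, R x y <->
         edited (nom_upd (nom_upd (nom_upd g k w) (k + 1) v) (k + 2) u) E x y)
    by (intros v u x y; rewrite HR; apply edited_agree with k; auto;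
        intros n Hn; rewrite !nom_upd_lt; auto; lia).
  - apply Hstep with (R' := fun _ => R); auto.
    intros v; rewrite he_edge_sat, nom_upd_same, nom_upd_lt, nom_upd_same by lia; auto.
  - destruct o;
      (* Local operators match [Hstep], global ones [Hpair]; the edited relation is found by
         unification. *)
      first
        [ apply (Hstep k _ g w _ _ (fun v => _));
          [simpl; repeat split; auto; lia | exact IHa | intros v | intros v x y];
          simpl; rewrite (HR2 v)
        | apply (Hpair k _ g w _ _ (fun v u => _));
          [simpl; repeat split; auto; lia | exact IHa | intros v u | intros v u x y];
          simpl; rewrite (HR3 v u) ];
      rewrite ?he_edge_sat;
      repeat (rewrite nom_upd_same || rewrite nom_upd_lt by lia); tauto.
Qed.

Lemma leq_expr_he (o : rc_op) : leq_expr (ML o) HL_E_down.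
Proof.
  assert (C : forall phi : ml_form o, he_closed (he_tr 0 nil phi)).
  { intros phi n Hn; apply he_tr_free in Hn; simpl; auto; inversion Hn. }
  exists (fun phi => exist he_closed (he_tr 0 nil phi) (C phi)).
  intros M w phi; simpl.
  assert (H : forall g, ml_sat M w phi <-> he_sat g w (he_tr 0 nil phi)).
  { intros g; destruct M as [W i R V].
    apply (he_tr_sat phi (M := Model i R V)); simpl; easy. }
  split; [intros Hw g; now apply H | intros Hg; apply (H (fun _ => w)), Hg].
Qed.

(** * Strictness *)

(** Infinitude is stated as escaping every finite list, so that an edit is absorbed by adding one
    endpoint to the list. *)
Record saturated (M : model) : Prop := {
  saturated_val : forall p w, ~ val M p w;
  saturated_succ : forall (l : list M) w, exists v, ~ In v l /\ rel M w v;
  saturated_nonsucc : forall (l : list M) w, exists v, ~ In v l /\ ~ rel M w v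
}.

Lemma saturated_del (M : model) (v u : M) : saturated M -> saturated (rel_del M v u).
Proof.
  intros [V P N]; constructor; simpl; auto; intros l w.
  (* A successor other than [u] survives the deletion. *)
  - destruct (P (u :: l) w) as (z & Hz & H); exists z; simpl in Hz; intuition congruence.
  - destruct (N l w) as (z & Hz & H); exists z; tauto.
Qed.

Lemma saturated_add (M : model) (v u : M) : saturated M -> saturated (rel_add M v u).
Proof.
  intros [V P N]; constructor; simpl; auto; intros l w.
  - destruct (P l w) as (z & Hz & H); exists z; tauto.
  - destruct (N (u :: l) w) as (z & Hz & H); exists z; simpl in Hz; intuition congruence.
Qed.

(** [rel_swap] unfolds to an addition after a deletion. *)
Lemma saturated_swap (M : model) (u v : M) : saturated M -> saturated (rel_swap M u v).
Proof.
  intros H; exact (@saturated_add (rel_del M v u) u v (saturated_del v u H)).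
Qed.

(** Relating all pointed saturated models to one another gives a bisimulation: any step of one is
    matched by an arbitrary step of the same kind in the other, and both results are saturated
    again. *)
Lemma saturated_equiv (o : rc_op) (phi : ml_form o) :
  forall (M N : model) (w : M) (z : N), saturated M -> saturated N ->
  ml_sat M w phi <-> ml_sat N z phi.
Proof.
  induction phi as [|p|a IHa|a IHa b IHb|a IHa|a IHa]; intros M N w z.
  - easy.
  - intros HM HN; simpl; split; intros H;
      [destruct (saturated_val HM _ _ H) | destruct (saturated_val HN _ _ H)].
  - intros HM HN; simpl; rewrite (IHa M N w z HM HN); tauto.
  - intros HM HN; simpl; rewrite (IHa M N w z HM HN), (IHb M N w z HM HN); tauto.
  - enough (G : forall (M N : model) (w : M) (z : N), saturated M -> saturated N ->
      ml_sat M w (MDia a) -> ml_sat N z (MDia a)) by (intros; split; now apply G).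
    clear M N w z; intros M N w z HM HN (v & Hv & H).
    destruct (saturated_succ HN nil z) as (y & _ & Hy).
    exists y; split; auto; now apply (IHa M N v y).
  - enough (G : forall (M N : model) (w : M) (z : N), saturated M -> saturated N ->
      ml_sat M w (MOp a) -> ml_sat N z (MOp a)) by (intros; split; now apply G).
    clear M N w z; intros M N w z HM HN.
    assert (IH : forall (M' N' : model) (w' : M') (z' : N'),
      ml_sat M' w' a -> saturated M' -> saturated N' -> ml_sat N' z' a)
      by (intros M' N' w' z' H HM' HN'; now apply (IHa M' N' w' z')).
    (* The edge from [z] to [y] serves every deletion and swap, the missing edge from [z] to [x]
       every addition, local or global. *)
    destruct (saturated_succ HN nil z) as (y & _ & Hy).
    destruct (saturated_nonsucc HN nil z) as (x & _ & Hx).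
    destruct o; cbn [ml_sat].
    + intros (v & _ & H); exists y; split; auto.
      eapply IH; [exact H | now apply saturated_del ..].
    + intros (v & _ & H); exists x; split; auto.
      eapply IH; [exact H | now apply saturated_add ..].
    + intros (v & _ & H); exists y; split; auto.
      eapply IH; [exact H | now apply saturated_swap ..].
    + intros (v & u & _ & H); exists z, y; split; auto.
      eapply IH; [exact H | now apply saturated_del ..].
    + intros (v & u & _ & H); exists z, x; split; auto.
      eapply IH; [exact H | now apply saturated_add ..].
    + intros (v & u & _ & H); exists z, y; split; auto.
      eapply IH; [exact H | now apply saturated_swap ..].
Qed.

Definition even_model : model :=
  Model (inhabits 0) (fun _ y => Nat.Even y) (fun _ _ => False).

Lemma even_model_saturated : saturated even_model.
Proof.
  assert (F : forall (l : list nat) x, In x l -> x <= list_max l).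
  { intros l; apply Forall_forall, list_max_le; auto. }
  constructor; simpl; auto; intros l w.
  (* An even and then an odd number, each above the maximum of [l]. *)
  - exists (2 * S (list_max l)); split; [intros H; apply F in H; lia | eexists; eauto].
  - exists (2 * list_max l + 1); split; [intros H; apply F in H; lia |].
    intros [m Hm]; lia.
Qed.

Lemma not_leq_expr_ML (o : rc_op) (L : logic) (psi : form L) :
  sat L even_model 0 psi -> ~ sat L even_model 1 psi -> ~ leq_expr L (ML o).
Proof.
  intros H0 H1 [Tr H]; apply H1, H; apply H in H0; simpl in *.
  eapply saturated_equiv; [exact even_model_saturated.. | exact H0].
Qed.

Lemma not_leq_expr_hat (o : rc_op) : ~ leq_expr HL_at_down (ML o).
Proof.
  assert (C : hat_closed (ADown 0 (ADia (ANom 0)))) by (intros n [H1 H2]; auto).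
  apply (@not_leq_expr_ML o HL_at_down (exist hat_closed _ C)); simpl.
  - intros g; exists 0; split; [now exists 0 | reflexivity].
  (* Any valuation would do, as nominal 0 is rebound to the point 1; the successor [v] would be both
     even and equal to 1. *)
  - intros H; destruct (H (fun _ => 0)) as (v & [m Hm] & H1).
    cbv in H1; lia.
Qed.

Lemma not_leq_expr_he (o : rc_op) : ~ leq_expr HL_E_down (ML o).
Proof.
  assert (C : he_closed (EDown 0 (EDia (ENom 0)))) by (intros n [H1 H2]; auto).
  apply (@not_leq_expr_ML o HL_E_down (exist he_closed _ C)); simpl.
  - intros g; exists 0; split; [now exists 0 | reflexivity].
  - intros H; destruct (H (fun _ => 0)) as (v & [m Hm] & H1).
    cbv in H1; lia.
Qed.

Theorem theorem4 :
  (forall o1 : rc_op, o1 = sb \/ o1 = sw -> lt_expr (ML o1) HL_at_down) /\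
  (forall o2 : rc_op, o2 = gsb \/ o2 = gsw \/ o2 = br \/ o2 = gbr ->
     lt_expr (ML o2) HL_E_down).
Proof.
  split; intros o Ho; split.
  - now apply leq_expr_hat.
  - apply not_leq_expr_hat.
  - apply leq_expr_he.
  - apply not_leq_expr_he.
Qed.
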